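(* Let $\mathbf{C}$ be a category with finite monic phased coproducts with transitive phases, and let $I$ be a phase generator in $\mathbf{C}$. Then the category $\mathsf{GP}(\mathbf{C})$ (formed with respect to $I$) has finite coproducts, and these are monic. Moreover, setting, for each object $\mathbf{A} = A \mathbin{\dot{+}} I$ of $\mathsf{GP}(\mathbf{C})$, $$\mathbb{T}_{\mathbf{A}} := \{ U \colon \mathbf{A} \to \mathbf{A} \mid U \text{ is a phase of the phased coproduct } A \mathbin{\dot{+}} I \text{ in } \mathbf{C}\}$$ defines a choice of trivial isomorphisms on $\mathsf{GP}(\mathbf{C})$, and for its congruence $\sim$ the functor $[-] \colon \mathsf{GP}(\mathbf{C}) \to \mathbf{C}$ induces an equivalence of categories $$\mathbf{C} \simeq \mathsf{GP}(\mathbf{C})/\!\sim .$$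
   Context: **Phased coproducts.** A phased coproduct of a family $(A_i)_{i \in J}$ of objects is an object $A$ with morphisms $\kappa_i \colon A_i \to A$ (coprojections) such that: (i) for every family $f_i \colon A_i \to B$ there is $f \colon A \to B$ with $f \circ \kappa_i = f_i$ for all $i$; (ii) any $f, f' \colon A \to B$ with $f \circ \kappa_i = f' \circ \kappa_i$ for all $i$ satisfy $f' = f \circ U$ for some endomorphism $U$ of $A$ with $U \circ \kappa_i = \kappa_i$ for all $i$. Any endomorphism $U$ of $A$ with $U \circ \kappa_i = \kappa_i$ for all $i$ is called a phase. A binary phased coproduct is written $A \mathbin{\dot{+}} B$. A category has finite phased coproducts if every finite (possibly empty) family has one. (Phased) coproducts are monic if all coprojections are monomorphisms. **Diagonal morphisms, transitive phases.** A morphism $f \colon A \mathbin{\dot{+}} B \to C \mathbin{\dot{+}} D$ is diagonal if $f \circ \kappa_A = \kappa_C \circ g$ and $f \circ \kappa_B = \kappa_D \circ h$ for some $g, h$. The category has transitive phases if for every diagonal $f \colon A \mathbin{\dot{+}} B \to C \mathbin{\dot{+}} D$ and phase $U$ of $A \mathbin{\dot{+}} B$ there is a phase $V$ of $C \mathbin{\dot{+}} D$ with $f \circ U = V \circ f$. **Phase generator.** A morphism $f \colon A \mathbin{\dot{+}} B \to C$ is phase monic if $f \circ U = f \circ V$ implies $U = V$ for all phases $U, V$ of $A \mathbin{\dot{+}} B$; a morphism $g \colon C \to A \mathbin{\dot{+}} B$ is phase epic if $U \circ g = V \circ g$ implies $U = V$ for all phases $U,V$. An object $I$ is a phase generator if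 (a) any $\triangledown \colon I \mathbin{\dot{+}} I \to I$ with $\triangledown \circ \kappa_1 = \mathrm{id}_I = \triangledown \circ \kappa_2$ is phase monic; (b) any diagonal monomorphism $m \colon I \mathbin{\dot{+}} I \to A \mathbin{\dot{+}} B$ is phase epic. **The category $\mathsf{GP}(\mathbf{C})$.** Given $\mathbf{C}$ with finite phased coproducts and a distinguished object $I$: objects are phased coproducts $\mathbf{A} = A \mathbin{\dot{+}} I$ in $\mathbf{C}$ (including as data $A$, $I$, $\kappa_A$, $\kappa_I$); morphisms $f \colon \mathbf{A} \to \mathbf{B}$ are diagonal morphisms $f\colon A \mathbin{\dot{+}} I \to B \mathbin{\dot{+}} I$ in $\mathbf{C}$ with $f \circ \kappa_I = \kappa_I$; composition and identities are as in $\mathbf{C}$. When phased coproducts are monic, $[-] \colon \mathsf{GP}(\mathbf{C}) \to \mathbf{C}$ is the functor sending $\mathbf{A} \mapsto A$ and $f \colon \mathbf{A} \to \mathbf{B}$ to the unique $[f] \colon A \to B$ with $f \circ \kappa_A = \kappa_B \circ [f]$. **Trivial isomorphisms.** A choice of trivial isomorphisms on a category $\mathbf{D}$ is a choice, for each object $A$, of a subgroup $\mathbb{T}_A \subseteq \mathrm{Aut}(A)$ such that for all $f \colon A \to B$ and $q \in \mathbb{T}_B$ there is $p \in \mathbb{T}_A$ with $f \circ p = q \circ f$. Its congruence on morphisms $f,g \colon A \to B$ is: $f \sim g$ iff $f = g \circ p$ for some $p \in \mathbb{T}_A$; $\mathbf{D}/\!\sim$ is the quotient category with the same objects and with $\sim$-classes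 as morphisms. *)

(* Defs.v *)
From mathcomp Require Import all_boot.
From mathcomp Require Import boolp.

Set Implicit Arguments.
Unset Strict Implicit.
Unset Printing Implicit Defensive.

Declare Scope cat_scope.
Delimit Scope cat_scope with cat.
Local Open Scope cat_scope.

#[local] Obligation Tactic := idtac.

Record category := Category {
  Ob :> Type;
  Hom : Ob -> Ob -> Type;
  idm : forall A, Hom A A;
  compm : forall A B D, Hom B D -> Hom A B -> Hom A D;
  compm1 : forall A B (f : Hom A B), compm f (idm A) = f;
  comp1m : forall A B (f : Hom A B), compm (idm B) f = f;
  compmA : forall A B D E (h : Hom D E) (g : Hom B D) (f : Hom A B),
    compm h (compm g f) = compm (compm h g) f }.

Arguments Hom {c} A B.
Arguments idm {c} A.
Arguments compm {c A B D} g f.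

Notation "g ∘ f" := (compm g f) (at level 40, left associativity) : cat_scope.

Definition monic (C : category) (A B : C) (m : Hom A B) : Prop :=
  forall (X : C) (f g : Hom X A), m ∘ f = m ∘ g -> f = g.

Definition inverse_of (C : category) (A B : C) (f : Hom A B) (g : Hom B A) :
    Prop :=
  g ∘ f = idm A /\ f ∘ g = idm B.

Definition is_iso (C : category) (A B : C) (f : Hom A B) : Prop :=
  exists g : Hom B A, inverse_of f g.

Record functor (C D : category) := Functor {
  fob :> C -> D;
  fmap : forall A B : C, Hom A B -> Hom (fob A) (fob B);
  fmap1 : forall A : C, fmap (idm A) = idm (fob A);
  fmapM : forall (A B E : C) (g : Hom B E) (f : Hom A B),
    fmap (g ∘ f) = fmap g ∘ fmap f }.

Arguments fmap {C D} _ {A B} _.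

Definition id_functor (C : category) : functor C C :=
  @Functor C C (fun A => A) (fun _ _ f => f)
    (fun _ => erefl) (fun _ _ _ _ _ => erefl).

Program Definition comp_functor (C D E : category)
    (G : functor D E) (F : functor C D) : functor C E :=
  @Functor C E (fun A => G (F A)) (fun _ _ f => fmap G (fmap F f)) _ _.
Next Obligation. by move=> * /=; rewrite !fmap1. Qed.
Next Obligation. by move=> * /=; rewrite !fmapM. Qed.

Definition naturally_isomorphic (C D : category) (F G : functor C D) : Prop :=
  exists eta : forall A : C, Hom (F A) (G A),
    (forall A, is_iso (eta A)) /\
    (forall (A B : C) (f : Hom A B), fmap G f ∘ eta A = eta B ∘ fmap F f).

Definition is_equivalence (C D : category) (F : functor C D) : Prop :=
  exists G : functor D C,
    naturally_isomorphic (comp_functor G F) (id_functor C) /\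
    naturally_isomorphic (comp_functor F G) (id_functor D).

Section Coproducts.
Variable C : category.

Definition is_coproduct (J : Type) (A : J -> C) (S : C)
    (k : forall i, Hom (A i) S) : Prop :=
  forall (B : C) (f : forall i, Hom (A i) B),
    exists! h : Hom S B, forall i, h ∘ k i = f i.

Definition is_phase (J : Type) (A : J -> C) (S : C)
    (k : forall i, Hom (A i) S) (U : Hom S S) : Prop :=
  forall i, U ∘ k i = k i.

Definition is_phased_coproduct (J : Type) (A : J -> C) (S : C)
    (k : forall i, Hom (A i) S) : Prop :=
  (forall (B : C) (f : forall i, Hom (A i) B),
     exists h : Hom S B, forall i, h ∘ k i = f i) /\
  (forall (B : C) (f f' : Hom S B), (forall i, f ∘ k i = f' ∘ k i) ->
     exists U : Hom S S, is_phase k U /\ f' = f ∘ U).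

Definition has_finite_coproducts : Prop :=
  forall (J : finType) (A : J -> C),
    exists (S : C) (k : forall i, Hom (A i) S), is_coproduct k.

Definition finite_coproducts_monic : Prop :=
  forall (J : finType) (A : J -> C) (S : C) (k : forall i, Hom (A i) S),
    is_coproduct k -> forall i, monic (k i).

Definition has_finite_phased_coproducts : Prop :=
  forall (J : finType) (A : J -> C),
    exists (S : C) (k : forall i, Hom (A i) S), is_phased_coproduct k.

Definition finite_phased_coproducts_monic : Prop :=
  forall (J : finType) (A : J -> C) (S : C) (k : forall i, Hom (A i) S),
    is_phased_coproduct k -> forall i, monic (k i).

(* Binary families are families indexed by bool, with true for the first summand. *)
Definition pair_ob (A B : C) (b : bool) : C := if b then A else B.

Definition pair_hom (A B S : C) (f : Hom A S) (g : Hom B S) :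
    forall b, Hom (pair_ob A B b) S :=
  fun b => match b with true => f | false => g end.

Record phased_sum (A B : C) := PhasedSum {
  psum :> C;
  in1 : Hom A psum;
  in2 : Hom B psum;
  psumP : is_phased_coproduct (pair_hom in1 in2) }.

Definition phase (A B : C) (S : phased_sum A B) (U : Hom S S) : Prop :=
  is_phase (pair_hom (in1 S) (in2 S)) U.

Definition diagonal (A B A' B' : C) (S : phased_sum A B)
    (S' : phased_sum A' B') (f : Hom S S') : Prop :=
  (exists g : Hom A A', f ∘ in1 S = in1 S' ∘ g) /\
  (exists h : Hom B B', f ∘ in2 S = in2 S' ∘ h).

Definition transitive_phases : Prop :=
  forall (A B A' B' : C) (S : phased_sum A B) (S' : phased_sum A' B')
    (f : Hom S S'), diagonal f ->
    forall U : Hom S S, phase U ->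
      exists V : Hom S' S', phase V /\ f ∘ U = V ∘ f.

Definition phase_monic (A B X : C) (S : phased_sum A B) (f : Hom S X) : Prop :=
  forall U V : Hom S S, phase U -> phase V -> f ∘ U = f ∘ V -> U = V.

Definition phase_epic (A B X : C) (S : phased_sum A B) (g : Hom X S) : Prop :=
  forall U V : Hom S S, phase U -> phase V -> U ∘ g = V ∘ g -> U = V.

Definition phase_generator (I : C) : Prop :=
  (forall (S : phased_sum I I) (d : Hom S I),
     d ∘ in1 S = idm I -> d ∘ in2 S = idm I -> phase_monic d) /\
  (forall (S : phased_sum I I) (A B : C) (S' : phased_sum A B) (m : Hom S S'),
     diagonal m -> monic m -> phase_epic m).

End Coproducts.

Section Quotient.
Variable D : category.
Variable T : forall A : D, Hom A A -> Prop.

Record trivial_isos : Prop := TrivialIsos {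
  triv_iso : forall (A : D) (p : Hom A A), T p -> is_iso p;
  triv1 : forall A : D, T (idm A);
  trivM : forall (A : D) (p q : Hom A A), T p -> T q -> T (p ∘ q);
  trivV : forall (A : D) (p q : Hom A A), T p -> inverse_of p q -> T q;
  triv_lift : forall (A B : D) (f : Hom A B) (q : Hom B B), T q ->
    exists p : Hom A A, T p /\ f ∘ p = q ∘ f }.

Definition triv_eq (A B : D) (f g : Hom A B) : Prop :=
  exists p : Hom A A, T p /\ f = g ∘ p.

Hypothesis HT : trivial_isos.

Lemma triv_eq_refl (A B : D) (f : Hom A B) : triv_eq f f.
Proof. by exists (idm A); split; [exact: triv1 | rewrite compm1]. Qed.

Lemma triv_eq_sym (A B : D) (f g : Hom A B) : triv_eq f g -> triv_eq g f.
Proof.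
move=> [p [Tp ->]]; have [q pq] := triv_iso HT Tp.
exists q; split; first exact: (trivV HT Tp pq).
by rewrite -compmA (proj2 pq) compm1.
Qed.

Lemma triv_eq_trans (A B : D) (f g h : Hom A B) :
  triv_eq f g -> triv_eq g h -> triv_eq f h.
Proof.
move=> [p [Tp ->]] [q [Tq ->]]; exists (q ∘ p).
by split; [exact: trivM | rewrite compmA].
Qed.

Lemma triv_eq_comp (A B E : D) (g g' : Hom B E) (f f' : Hom A B) :
  triv_eq g g' -> triv_eq f f' -> triv_eq (g ∘ f) (g' ∘ f').
Proof.
move=> [q [Tq ->]] [p [Tp ->]]; have [r [Tr rE]] := triv_lift HT f' Tq.
exists (r ∘ p); split; first exact: trivM.
by rewrite !compmA -(compmA g' q) -rE !compmA.
Qed.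

(* Morphisms of the quotient are literally equivalence classes. *)
Definition triv_class (A B : D) : Type :=
  {c : Hom A B -> Prop | exists f, c = triv_eq f}.

Definition cls (A B : D) (f : Hom A B) : triv_class A B :=
  exist _ (triv_eq f) (ex_intro _ f erefl).

Definition rep (A B : D) (c : triv_class A B) : Hom A B :=
  projT1 (cid (proj2_sig c)).

Lemma repK (A B : D) (c : triv_class A B) : cls (rep c) = c.
Proof.
rewrite /cls /rep; case: (cid _) => f /= fE.
by case: c fE => c cP /= fE; apply: eq_exist.
Qed.

Lemma clsP (A B : D) (f g : Hom A B) : cls f = cls g <-> triv_eq f g.
Proof.
split=> [[->] | fg]; first exact: triv_eq_refl.
apply: eq_exist; apply: funext => h; apply: propext; split=> H.
  exact: triv_eq_trans (triv_eq_sym fg) H.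
exact: triv_eq_trans fg H.
Qed.

Lemma rep_cls (A B : D) (f : Hom A B) : triv_eq (rep (cls f)) f.
Proof. by apply/clsP; rewrite repK. Qed.

Definition cls_comp (A B E : D) (c : triv_class B E) (d : triv_class A B) :
    triv_class A E :=
  cls (rep c ∘ rep d).

Lemma cls_compE (A B E : D) (g : Hom B E) (f : Hom A B) :
  cls_comp (cls g) (cls f) = cls (g ∘ f).
Proof. by apply/clsP; apply: triv_eq_comp; exact: rep_cls. Qed.

Program Definition quotient : category :=
  @Category D triv_class (fun A => cls (idm A)) cls_comp _ _ _.
Next Obligation. by move=> A B f /=; rewrite -(repK f) cls_compE compm1. Qed.
Next Obligation. by move=> A B f /=; rewrite -(repK f) cls_compE comp1m. Qed.
Next Obligation.
move=> A B E X h g f /=.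
by rewrite -(repK f) -(repK g) -(repK h) !cls_compE compmA.
Qed.

Section Induced.
Variables (E : category) (F : functor D E).

Definition respects_triv : Prop :=
  forall (A B : D) (f g : Hom A B), triv_eq f g -> fmap F f = fmap F g.

Hypothesis HF : respects_triv.

Lemma fmap_rep (A B : D) (f : Hom A B) : fmap F (rep (cls f)) = fmap F f.
Proof. by apply: HF; exact: rep_cls. Qed.

Program Definition induced : functor quotient E :=
  @Functor quotient E (fun A => F A) (fun _ _ c => fmap F (rep c)) _ _.
Next Obligation. by move=> A /=; rewrite fmap_rep fmap1. Qed.
Next Obligation. by move=> A B X g f /=; rewrite /cls_comp fmap_rep fmapM. Qed.

Lemma inducedE (A B : D) (f : Hom A B) :
  @fmap _ _ induced A B (cls f) = fmap F f.
Proof. exact: fmap_rep. Qed.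

End Induced.
End Quotient.

Section GP.
Variables (C : category) (I : C).

Record gp_ob := GPOb {
  gp_base : C;
  gp_sum :> phased_sum gp_base I }.

Definition gp_hom_axiom (X Y : gp_ob) (f : Hom X Y) : Prop :=
  diagonal f /\ f ∘ in2 X = in2 Y.

Definition gp_hom (X Y : gp_ob) : Type := {f : Hom X Y | gp_hom_axiom f}.

Lemma gp_id_subproof (X : gp_ob) : @gp_hom_axiom X X (idm X).
Proof.
by split; [split; eexists; rewrite comp1m -[LHS]compm1 | rewrite comp1m].
Qed.

Lemma gp_comp_subproof (X Y Z : gp_ob) (g : gp_hom Y Z) (f : gp_hom X Y) :
  @gp_hom_axiom X Z (sval g ∘ sval f).
Proof.
case: g f => [g [[[g1 g1E] [g2 g2E]] gI]] [f [[[f1 f1E] [f2 f2E]] fI]] /=.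
split; last by rewrite -compmA fI gI.
split; [exists (g1 ∘ f1) | exists (g2 ∘ f2)].
  by rewrite -compmA f1E !compmA g1E.
by rewrite -compmA f2E !compmA g2E.
Qed.

Program Definition GP : category :=
  @Category gp_ob gp_hom
    (fun X => exist _ (idm _) (gp_id_subproof X))
    (fun X Y Z g f => exist _ (sval g ∘ sval f) (gp_comp_subproof g f)) _ _ _.
Next Obligation. by move=> X Y [f fP] /=; apply: eq_exist; exact: compm1. Qed.
Next Obligation. by move=> X Y [f fP] /=; apply: eq_exist; exact: comp1m. Qed.
Next Obligation. by move=> * /=; apply: eq_exist; exact: compmA. Qed.

Definition gp_phase (X : GP) (U : Hom X X) : Prop :=
  @phase C (gp_base X) I X (sval U).

Section Bracket.
Hypothesis Hmonic : finite_phased_coproducts_monic C.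

Lemma in1_monic (A B : C) (S : phased_sum A B) : monic (in1 S).
Proof. exact: (@Hmonic bool _ _ _ (psumP S) true). Qed.

(* The choice below is unique, since in1 Y is monic. *)
Definition bracket_hom (X Y : GP) (f : Hom X Y) : Hom (gp_base X) (gp_base Y) :=
  projT1 (cid (proj1 (proj1 (proj2_sig f)))).

Lemma bracket_homE (X Y : GP) (f : Hom X Y) :
  sval f ∘ in1 X = in1 Y ∘ bracket_hom f.
Proof. exact: projT2 (cid (proj1 (proj1 (proj2_sig f)))). Qed.

Program Definition bracket : functor GP C :=
  @Functor GP C gp_base bracket_hom _ _.
Next Obligation.
by move=> X /=; apply: (@in1_monic _ _ X); rewrite -bracket_homE comp1m compm1.
Qed.
Next Obligation.
move=> X Y Z g f /=; apply: (@in1_monic _ _ Z).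
by rewrite -bracket_homE compmA -bracket_homE -!compmA -bracket_homE.
Qed.

End Bracket.
End GP.

(* Main.v *)
Require Import Defs.
From mathcomp Require Import all_boot.
From mathcomp Require Import boolp.

(** Up to phases, iterated phased coproducts may be reassociated.  Hence the
    coproduct in [GP I] of [X = A +. I] and [Y = B +. I] is [T = X +. B], seen
    as [(A +. B) +. I].  A cotuple of [f] and [g] exists in [C] only up to a
    phase of [Y], and transitivity along [Y -> T] absorbs this phase in one of
    [X +. B].  For uniqueness, map [X +. Y] onto [T] by merging the two copies
    of [I]: two cotuples of the same morphisms become equal up to a phase [U] of
    [X +. Y].  The copies of [I] give a diagonal monomorphism from [I +. I] to
    [X +. Y], along which [U] restricts to a phase of [I +. I] that is
    invisible to the codiagonal; so [U] is trivial because [I] is a phase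
    generator.  Finally, [[-]] is full, surjective on objects, and identifies
    exactly the morphisms that differ by a phase. *)

Set Implicit Arguments.
Unset Strict Implicit.
Unset Printing Implicit Defensive.

Local Open Scope cat_scope.

(** * Invertibility of morphisms and phases *)

Section CategoryFacts.
Variable C : category.

Lemma monic_comp (A B D : C) (g : Hom B D) (f : Hom A B) :
  monic g -> monic f -> monic (g ∘ f).
Proof. by move=> mg mf X u v; rewrite -!compmA => /mg /mf. Qed.

Lemma monic_compr (A B D : C) (g : Hom B D) (f : Hom A B) :
  monic (g ∘ f) -> monic f.
Proof. by move=> mgf X u v uv; apply: mgf; rewrite -!compmA uv. Qed.

Lemma is_iso_monic (A B : C) (f : Hom A B) : is_iso f -> monic f.
Proof.
by move=> [g [gf _]] X u v uv; rewrite -[u]comp1m -[v]comp1m -gf -!compmA uv.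
Qed.

Lemma is_iso_epic (A B X : C) (f : Hom A B) (u v : Hom B X) :
  is_iso f -> u ∘ f = v ∘ f -> u = v.
Proof.
by move=> [g [_ fg]] uv; rewrite -[u]compm1 -[v]compm1 -fg !compmA uv.
Qed.

(** The right inverse [V] of [U] has itself a right inverse [W], and [U = U ∘ (V ∘ W) = W] makes [V]
    two-sided. *)
Lemma right_invertible_iso (S : C) (P : Hom S S -> Prop) :
  (forall U, P U -> exists V, P V /\ idm S = U ∘ V) ->
  forall U, P U -> exists V, P V /\ inverse_of U V.
Proof.
move=> Pinv U PU; have [V [PV UV]] := Pinv U PU.
have [W [_ VW]] := Pinv V PV; exists V; split=> //; split=> //.
suff -> : U = W by [].
by rewrite -[U]compm1 VW compmA -UV comp1m.
Qed.

Lemma is_iso_of_inverses (A B : C) (f : Hom A B) (g : Hom B A) :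
  is_iso (g ∘ f) -> is_iso (f ∘ g) -> is_iso f.
Proof.
move=> [u [u1 _]] fg_iso; exists (u ∘ g); split; first by rewrite -compmA.
apply: (is_iso_epic fg_iso).
by rewrite comp1m -compmA (compmA (u ∘ g)) -(compmA u g f) u1 comp1m.
Qed.

Lemma is_phase_inv (J : Type) (A : J -> C) (S : C) (k : forall i, Hom (A i) S)
    (U : Hom S S) :
  is_phased_coproduct k -> is_phase k U ->
  exists V, is_phase k V /\ inverse_of U V.
Proof.
move=> [_ kE]; apply: right_invertible_iso => {}U phU.
by apply: kE => i; rewrite comp1m phU.
Qed.

End CategoryFacts.

(** * Binary and iterated phased coproducts *)

Section PhasedSums.
Variable C : category.

Lemma is_phased_coproduct_pair (A B S : C) (k1 : Hom A S) (k2 : Hom B S) :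
  (forall (X : C) (f : Hom A X) (g : Hom B X),
     exists h : Hom S X, h ∘ k1 = f /\ h ∘ k2 = g) ->
  (forall (X : C) (h h' : Hom S X), h ∘ k1 = h' ∘ k1 -> h ∘ k2 = h' ∘ k2 ->
     exists U, U ∘ k1 = k1 /\ U ∘ k2 = k2 /\ h' = h ∘ U) ->
  is_phased_coproduct (pair_hom k1 k2).
Proof.
move=> ex eq; split=> [X f|X h h' hh'].
  have [h [h1 h2]] := ex X (f true) (f false).
  by exists h; case.
have [U [U1 [U2 hU]]] := eq X h h' (hh' true) (hh' false).
by exists U; split=> //; case.
Qed.

Section OneSum.
Variables (A B : C) (S : phased_sum A B).

Lemma phaseP (U : Hom S S) :
  phase U <-> U ∘ in1 S = in1 S /\ U ∘ in2 S = in2 S.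
Proof.
by split=> [phU|[U1 U2]]; [split; [exact: (phU true)|exact: (phU false)]|case].
Qed.

Lemma cotuple (X : C) (f : Hom A X) (g : Hom B X) :
  exists h : Hom S X, h ∘ in1 S = f /\ h ∘ in2 S = g.
Proof.
have [h hE] := proj1 (psumP S) X (pair_hom f g).
by exists h; split; [exact: (hE true)|exact: (hE false)].
Qed.

Lemma eq_up_to_phase (X : C) (h h' : Hom S X) :
  h ∘ in1 S = h' ∘ in1 S -> h ∘ in2 S = h' ∘ in2 S ->
  exists U : Hom S S, phase U /\ h' = h ∘ U.
Proof. by move=> h1 h2; apply: (proj2 (psumP S)); case. Qed.

Lemma phase_inv (U : Hom S S) :
  phase U -> exists V : Hom S S, phase V /\ inverse_of U V.
Proof. exact: is_phase_inv (psumP S). Qed.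

Lemma phase_iso (U : Hom S S) : phase U -> is_iso U.
Proof. by case/phase_inv=> V [_ UV]; exists V. Qed.

Lemma phase1 : phase (idm S).
Proof. by apply/phaseP; rewrite !comp1m. Qed.

Lemma phase_sum_swap : is_phased_coproduct (pair_hom (in2 S) (in1 S)).
Proof.
apply: is_phased_coproduct_pair => [X f g|X h h' h2 h1].
  by have [h [h1 h2]] := cotuple g f; exists h.
by have [U [/phaseP [U1 U2] hU]] := eq_up_to_phase h1 h2; exists U.
Qed.

Lemma phase_sum_transport (T : C) (p : Hom S T) :
  is_iso p -> is_phased_coproduct (pair_hom (p ∘ in1 S) (p ∘ in2 S)).
Proof.
move=> [q [qp pq]]; apply: is_phased_coproduct_pair => [X f g|X h h'].
  have [h [h1 h2]] := cotuple f g; exists (h ∘ q).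
  by rewrite -!compmA !(compmA q) qp !comp1m.
rewrite !compmA => h1 h2.
have [U [/phaseP [U1 U2] hU]] := eq_up_to_phase h1 h2.
exists (p ∘ U ∘ q).
rewrite -!compmA !(compmA q) qp !comp1m U1 U2; split=> //; split=> //.
by rewrite !compmA -hU -compmA pq compm1.
Qed.

End OneSum.

Section Nested.
Variables (A B D : C) (S : phased_sum A B) (T : phased_sum S D).

(** The phases of [T] as a ternary phased coproduct of [A], [B], [D]; they need not fix [in1 T]. *)
Definition nested_phase (U : Hom T T) : Prop :=
  U ∘ (in1 T ∘ in1 S) = in1 T ∘ in1 S /\
  U ∘ (in1 T ∘ in2 S) = in1 T ∘ in2 S /\ U ∘ in2 T = in2 T.

(** A phase [U] of [S] corrects [h ∘ in1 T]; it extends to [W] on [T] fixing [in2 T], and a phase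
    [V] of [T] corrects the rest. *)
Lemma eq_up_to_nested_phase (X : C) (h h' : Hom T X) :
  h ∘ (in1 T ∘ in1 S) = h' ∘ (in1 T ∘ in1 S) ->
  h ∘ (in1 T ∘ in2 S) = h' ∘ (in1 T ∘ in2 S) ->
  h ∘ in2 T = h' ∘ in2 T ->
  exists U, nested_phase U /\ h' = h ∘ U.
Proof.
rewrite !compmA => hA hB hD.
have [U [/phaseP [UA UB] hU]] := eq_up_to_phase hA hB.
have [W [W1 W2]] := cotuple T (in1 T ∘ U) (in2 T).
have h1 : (h ∘ W) ∘ in1 T = h' ∘ in1 T by rewrite hU -!compmA W1.
have h2 : (h ∘ W) ∘ in2 T = h' ∘ in2 T by rewrite -compmA W2.
have [V [/phaseP [V1 V2] hV]] := eq_up_to_phase h1 h2.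
exists (W ∘ V); split; last by rewrite compmA.
split; [|split].
- by rewrite compmA -(compmA W) V1 W1 -compmA UA.
- by rewrite compmA -(compmA W) V1 W1 -compmA UB.
- by rewrite -compmA V2.
Qed.

Lemma nested_phase_iso (U : Hom T T) : nested_phase U -> is_iso U.
Proof.
move=> phU; suff [V [_ UV]] : exists V, nested_phase V /\ inverse_of U V.
  by exists V.
apply: right_invertible_iso phU => {}U [UA [UB UD]].
by apply: eq_up_to_nested_phase; rewrite comp1m.
Qed.

End Nested.

Lemma phased_sum_exists :
  has_finite_phased_coproducts C ->
  forall A B : C, exists S : phased_sum A B, True.
Proof.
move=> Cfin A B; have [S [k [kex keq]]] := Cfin bool (pair_ob A B).
have kP : is_phased_coproduct (pair_hom (k true) (k false)).
  apply: is_phased_coproduct_pair => [X f g|X h h' h1 h2].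
    have [h hE] := kex X (pair_hom f g).
    by exists h; split; [exact: (hE true)|exact: (hE false)].
  have [|U [phU hU]] := keq X h h'; first by case.
  by exists U; split; [exact: (phU true)|split; first exact: (phU false)].
by exists (PhasedSum kP).
Qed.

(* [T] and a sum of [X] and [B] are both phased coproducts of [A], [B], [D]. *)
Lemma reassociate (A B D : C) (S : phased_sum A B) (T : phased_sum S D)
    (X : phased_sum A D) (k : Hom X T) :
  has_finite_phased_coproducts C ->
  k ∘ in1 X = in1 T ∘ in1 S -> k ∘ in2 X = in2 T ->
  is_phased_coproduct (pair_hom k (in1 T ∘ in2 S)).
Proof.
move=> Cfin kA kD; have [T' _] := phased_sum_exists Cfin X B.
have [p [pX pB]] := cotuple T' k (in1 T ∘ in2 S).
have [q1 [q1A q1B]] := cotuple S (in1 T' ∘ in1 X) (in2 T').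
have [q [qS qD]] := cotuple T q1 (in1 T' ∘ in2 X).
suff p_iso : is_iso p by rewrite -pX -pB; exact: phase_sum_transport.
(* Both composites preserve the coprojections of [A], [B] and [D]. *)
apply: (@is_iso_of_inverses _ _ _ p q); apply: nested_phase_iso.
- split; [|split].
  + by rewrite -compmA (compmA p) pX kA compmA qS q1A.
  + by rewrite -compmA (compmA p) pX kD qD.
  + by rewrite -compmA pB compmA qS q1B.
- split; [|split].
  + by rewrite -compmA (compmA q) qS q1A compmA pX kA.
  + by rewrite -compmA (compmA q) qS q1B pB.
  + by rewrite -compmA qD compmA pX kD.
Qed.

(* A sum with the empty phased coproduct is a unary phased coproduct. *)
Lemma in2_empty_epic (Z D : C) (k : forall i : void, Hom (of_void C i) Z)
    (S : phased_sum Z D) :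
  is_phased_coproduct k ->
  forall (X : C) (h h' : Hom S X), h ∘ in2 S = h' ∘ in2 S -> h = h'.
Proof.
move=> [kex keq].
(* Any two parallel maps out of [Z] agree up to an endomorphism of [Z], so agreement on [in2 S]
   suffices. *)
have fix_eq (X : C) (h h' : Hom S X) : h ∘ in2 S = h' ∘ in2 S ->
    exists U, U ∘ in2 S = in2 S /\ h' = h ∘ U.
  move=> hh'.
  have [|U [_ hU]] := keq X (h ∘ in1 S) (h' ∘ in1 S); first by case.
  have [W [W1 W2]] := cotuple S (in1 S ∘ U) (in2 S).
  have h1 : (h ∘ W) ∘ in1 S = h' ∘ in1 S by rewrite hU -!compmA W1.
  have h2 : (h ∘ W) ∘ in2 S = h' ∘ in2 S by rewrite -compmA W2.
  have [V [/phaseP [V1 V2] hV]] := eq_up_to_phase h1 h2.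
  by exists (W ∘ V); rewrite -compmA V2 compmA.
have [u _] := kex D (fun i => match i with end).
have [r [_ r2]] := cotuple S u (idm D).
(* [in2 S ∘ r] fixes [in2 S], hence is invertible, and so [in2 S] is epic. *)
have [V [_ rV]] : exists V, V ∘ in2 S = in2 S /\ inverse_of (in2 S ∘ r) V.
  apply: (@right_invertible_iso _ _ (fun U => U ∘ in2 S = in2 S)) => [U U2|].
    by apply: fix_eq; rewrite comp1m.
  by rewrite -compmA r2 compm1.
move=> X h h' hh'; apply: (@is_iso_epic _ _ _ _ (in2 S ∘ r)); first by exists V.
by rewrite !compmA hh'.
Qed.

End PhasedSums.

(** * Finite coproducts from binary ones *)

Section FiniteCoproducts.
Variable D : category.

Lemma is_coproduct_reindex (J K : Type) (e : J -> K) (e' : K -> J)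
    (A : K -> D) (S : D) (k : forall j, Hom (A (e j)) S) :
  cancel e e' -> cancel e' e -> is_coproduct k ->
  exists k' : forall x, Hom (A x) S, is_coproduct k'.
Proof.
move=> eK e'K kP.
exists (fun x => eq_rect _ (fun y => Hom (A y) S) (k (e' x)) _ (e'K x)) => B f.
(* The equality is a variable here, so that the transport can be eliminated. *)
have castE (h : Hom S B) x y (xy : x = y) (g : Hom (A x) S) :
    h ∘ g = f x <-> h ∘ eq_rect _ (fun z => Hom (A z) S) g _ xy = f y.
  by case: _ / xy.
have [h [hE hU]] := kP B (fun j => f (e j)).
exists h; split=> [x|h' h'E].
  exact: (proj1 (castE h _ x (e'K x) _) (hE (e' x))).
apply: hU => j; rewrite -(eK j); exact: (proj2 (castE h' _ _ (e'K _) _) (h'E _)).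
Qed.

Lemma has_finite_coproducts_of_binary :
  (exists Z : D, forall B : D, exists! h : Hom Z B, True) ->
  (forall A B : D, exists (S : D) (k1 : Hom A S) (k2 : Hom B S),
     forall (X : D) (f : Hom A X) (g : Hom B X),
       exists! h : Hom S X, h ∘ k1 = f /\ h ∘ k2 = g) ->
  has_finite_coproducts D.
Proof.
move=> [Z ZP] bin.
have ord_coprod n (A : 'I_n -> D) :
    exists (S : D) (k : forall i, Hom (A i) S), is_coproduct k.
  elim: n A => [A|n IHn A].
    exists Z, (fun i : 'I_0 => False_rect _ (notF (ltn_ord i))) => B f.
    have [h [_ hU]] := ZP B.
    by exists h; split=> [[]|h' _] //; apply: hU.
  (* [e] identifies [option 'I_n] with ['I_n.+1], with inverse [unlift ord0]. *)
  pose e (o : option 'I_n) := if o is Some i then lift ord0 i else ord0.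
  have [S [k kP]] := IHn (fun i => A (e (Some i))).
  have [T [k1 [k2 k12P]]] := bin (A ord0) S.
  pose k' (o : option 'I_n) : Hom (A (e o)) T :=
    match o with Some i => k2 ∘ k i | None => k1 end.
  suff k'P : is_coproduct k'.
    exists T; apply: (@is_coproduct_reindex _ _ e (unlift ord0) A T k') => //.
      by case=> [i|] /=; rewrite ?liftK ?unlift_none.
    by move=> i; case: unliftP => [j ->|->].
  move=> B f; have [g [gE gU]] := kP B (fun i => f (Some i)).
  have [h [[h1 h2] hU]] := k12P B (f None) g.
  exists h; split=> [[i|] //=|h' h'E]; first by rewrite compmA h2 gE.
  apply: hU; split; first exact: (h'E None).
  by symmetry; apply: gU => i; rewrite -compmA (h'E (Some i)).
move=> J A.
have [S [k kP]] := ord_coprod #|J| (fun i => A (enum_val i)).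
by exists S; apply: is_coproduct_reindex kP; [exact: enum_valK|exact: enum_rankK].
Qed.

(* [k i] is a factor of the coprojection of [A i] into [A i + S]. *)
Lemma finite_coproducts_monic_of_binary :
  (forall A B : D, exists (S : D) (k1 : Hom A S) (k2 : Hom B S),
     monic k1 /\
     forall (X : D) (f : Hom A X) (g : Hom B X),
       exists h : Hom S X, h ∘ k1 = f /\ h ∘ k2 = g) ->
  finite_coproducts_monic D.
Proof.
move=> bin J A S k kP i; have [T [k1 [k2 [k1m _]]]] := bin (A i) S.
(* Matching on [eqP] yields the equality along which [k1] is transported. *)
pose f j : Hom (A j) T :=
  match @eqP _ i j with
  | ReflectT ij => eq_rect _ (fun y => Hom (A y) T) k1 _ ij
  | ReflectF _ => k2 ∘ k j
  end.
have [h [hE _]] := kP T f; apply: (@monic_compr _ _ _ _ h).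
rewrite hE /f; case: eqP => // ii.
by rewrite (eq_axiomK ii).
Qed.

End FiniteCoproducts.

(** * Equivalences from full, faithful, essentially surjective functors *)

Lemma is_equivalence_of_full_faithful (D C : category) (F : functor D C) :
  (forall (A B : D) (g : Hom (F A) (F B)), exists f : Hom A B, fmap F f = g) ->
  (forall (A B : D) (f g : Hom A B), fmap F f = fmap F g -> f = g) ->
  (forall A : C, exists (X : D) (e : Hom (F X) A), is_iso e) ->
  is_equivalence F.
Proof.
move=> full faith surj.
pose s A := projT1 (cid (surj A)).
pose e A : Hom (F (s A)) A := projT1 (cid (projT2 (cid (surj A)))).
have eP A : is_iso (e A) by exact: projT2 (cid (projT2 (cid (surj A)))).
pose e' A := projT1 (cid (eP A)).
have e'e A : e' A ∘ e A = idm _ := proj1 (projT2 (cid (eP A))).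
have ee' A : e A ∘ e' A = idm _ := proj2 (projT2 (cid (eP A))).
pose lift A B (g : Hom (F A) (F B)) : Hom A B := projT1 (cid (full A B g)).
have liftK A B (g : Hom (F A) (F B)) : fmap F (lift A B g) = g.
  exact: projT2 (cid (full A B g)).
(* The inverse functor lifts the conjugate of [f] by the chosen isomorphisms; faithfulness makes it
   functorial. *)
pose m A B (f : Hom A B) : Hom (s A) (s B) := lift _ _ (e' B ∘ f ∘ e A).
have m1 A : m _ _ (idm A) = idm (s A).
  by apply: faith; rewrite liftK fmap1 compm1 e'e.
have mM A B E (g : Hom B E) (f : Hom A B) : m _ _ (g ∘ f) = m _ _ g ∘ m _ _ f.
  apply: faith; rewrite fmapM !liftK -!compmA (compmA (e B)) ee' comp1m.
  by rewrite !compmA.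
exists (Functor m1 mM); split.
  exists (fun A : D => lift (s (F A)) A (e (F A))); split=> [A|A B f] /=.
    exists (lift A (s (F A)) (e' (F A))).
    by split; apply: faith; rewrite fmapM fmap1 !liftK ?e'e ?ee'.
  by apply: faith; rewrite !fmapM !liftK -!compmA compmA ee' comp1m.
exists e; split=> [A|A B f /=]; first exact: eP.
by rewrite liftK -!compmA compmA ee' comp1m.
Qed.

(** * Phases and the bracket functor on [GP I] *)

Section GPFacts.
Variables (C : category) (I : C).
Hypothesis Cfin : has_finite_phased_coproducts C.
Hypothesis Cmonic : finite_phased_coproducts_monic C.

Lemma in2_monic (A B : C) (S : phased_sum A B) : monic (in2 S).
Proof. exact: (@Cmonic bool _ _ _ (psumP S) false). Qed.

Lemma gp_hom_eq (X Y : GP I) (f g : Hom X Y) : sval f = sval g -> f = g.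
Proof. by case: f g => [f fP] [g gP] /= fg; apply: eq_exist. Qed.

(** Fullness of the bracket functor: take a cotuple of [in1 Y ∘ g] and [in2 Y]. *)
Lemma gp_hom_lift (X Y : GP I) (g : Hom (gp_base X) (gp_base Y)) :
  exists f : Hom X Y, sval f ∘ in1 X = in1 Y ∘ g.
Proof.
have [f [f1 f2]] := cotuple X (in1 Y ∘ g) (in2 Y).
have fP : @gp_hom_axiom C I X Y f.
  by split=> //; split; [exists g|exists (idm I); rewrite compm1].
by exists (exist _ f fP).
Qed.

Lemma gp_phase_hom (X : GP I) (U : Hom (gp_sum X) (gp_sum X)) :
  phase U -> @gp_hom_axiom C I X X U.
Proof.
move=> /phaseP [U1 U2]; split=> //.
by split; [exists (idm _)|exists (idm _)]; rewrite compm1.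
Qed.

(** Both morphisms send [in2 X] to [in2 Y], so agreement on [in1 X] is agreement on both
    coprojections. *)
Lemma gp_phaseP (X Y : GP I) (f g : Hom X Y) :
  triv_eq (@gp_phase C I) f g <-> sval f ∘ in1 X = sval g ∘ in1 X.
Proof.
split=> [[p [/phaseP [p1 _] ->]]|fg]; first by rewrite /= -compmA p1.
have fg2 : sval g ∘ in2 X = sval f ∘ in2 X.
  by rewrite (proj2 (proj2_sig g)) (proj2 (proj2_sig f)).
have [U [phU fU]] := eq_up_to_phase (esym fg) fg2.
by exists (exist _ U (gp_phase_hom phU)); split=> //; exact: gp_hom_eq.
Qed.

Lemma gp_trivial_isos : trivial_isos (@gp_phase C I).
Proof.
split.
- move=> A p Tp; have [V [phV [Vp pV]]] := phase_inv Tp.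
  by exists (exist _ V (gp_phase_hom phV)); split; exact: gp_hom_eq.
- by move=> A; exact: phase1.
- move=> A p q /phaseP [p1 p2] /phaseP [q1 q2]; apply/phaseP => /=.
  by rewrite -!compmA q1 q2.
- move=> A p q /phaseP [p1 p2] [qp _]; apply/phaseP.
  move/(congr1 sval): qp => /= qp.
  by split; [rewrite -{1}p1|rewrite -{1}p2]; rewrite compmA qp comp1m.
- move=> A B f q /phaseP [q1 q2].
  (* Since [f] is diagonal and [q] fixes [in1 B], the maps [q ∘ f] and [f] agree on [in1 A]. *)
  have : triv_eq (@gp_phase C I) (q ∘ f : Hom A B) f.
    apply/gp_phaseP => /=; have [g gE] := proj1 (proj1 (proj2_sig f)).
    by rewrite -compmA gE compmA q1.
  by case=> p [Tp ->]; exists p.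
Qed.

Lemma bracket_eqP (X Y : GP I) (f g : Hom X Y) :
  fmap (bracket I Cmonic) f = fmap (bracket I Cmonic) g <->
  triv_eq (@gp_phase C I) f g.
Proof.
split=> [fg|/gp_phaseP fg].
  by apply/gp_phaseP; rewrite !bracket_homE; congr (_ ∘ _).
by apply: (in1_monic Cmonic (S := Y)); rewrite -!bracket_homE.
Qed.

Lemma bracket_equivalence (HT : trivial_isos (@gp_phase C I))
    (Hresp : respects_triv (@gp_phase C I) (bracket I Cmonic)) :
  is_equivalence (induced HT Hresp).
Proof.
apply: is_equivalence_of_full_faithful.
- move=> A B g; have [f fE] := gp_hom_lift (X := A) (Y := B) g.
  exists (cls (@gp_phase C I) f); rewrite inducedE.
  apply: (in1_monic Cmonic (S := B)).
  by rewrite -bracket_homE.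
- move=> A B f g; rewrite -(repK f) -(repK g) !inducedE => /bracket_eqP fg.
  exact/clsP.
- move=> A; have [S _] := phased_sum_exists Cfin A I.
  by exists (GPOb S), (idm A), (idm A); split; rewrite comp1m.
Qed.

(** The initial object is [Z +. I] with [Z] an empty phased coproduct: its [in2] is epic, and
    morphisms of [GP I] have a prescribed value on it. *)
Lemma gp_initial : exists Z : GP I, forall X : GP I, exists! h : Hom Z X, True.
Proof.
have [Z [k kP]] := Cfin (of_void C).
have [S _] := phased_sum_exists Cfin Z I.
exists (GPOb S) => X.
have [g _] := proj1 kP (gp_base X) (fun i => match i with end).
have [h _] := gp_hom_lift (X := GPOb S) (Y := X) g.
exists h; split=> // h' _; apply: gp_hom_eq; apply: (in2_empty_epic kP (S := S)).
by rewrite (proj2 (proj2_sig h)) (proj2 (proj2_sig h')).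
Qed.

(** * Binary coproducts in [GP I] *)

Hypothesis Ctrans : transitive_phases C.
Hypothesis Igen : phase_generator I.

Section MergingGenerators.
Variables (A B : C) (X : phased_sum A I) (Y : phased_sum B I).

(* The two copies of [I] in [(A +. I) +. (B +. I)] form a summand [I +. I]. *)
Lemma generator_pair_monic (T : phased_sum X Y) (S : phased_sum I I)
    (m : Hom S T) :
  m ∘ in1 S = in1 T ∘ in2 X -> m ∘ in2 S = in2 T ∘ in2 Y -> monic m.
Proof.
move=> m1 m2.
(* [r] maps onto [(A +. B) +. (I +. I)] summand by summand, so [r ∘ m] is [in2 Q] up to a phase. *)
have [P _] := phased_sum_exists Cfin A B.
have [Q _] := phased_sum_exists Cfin P S.
have [r1 [_ r1I]] := cotuple X (in1 Q ∘ in1 P) (in2 Q ∘ in1 S).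
have [r2 [_ r2I]] := cotuple Y (in1 Q ∘ in2 P) (in2 Q ∘ in2 S).
have [r [rX rY]] := cotuple T r1 r2.
have e1 : in2 Q ∘ in1 S = (r ∘ m) ∘ in1 S.
  by rewrite -compmA m1 compmA rX r1I.
have e2 : in2 Q ∘ in2 S = (r ∘ m) ∘ in2 S.
  by rewrite -compmA m2 compmA rY r2I.
have [V [phV rm]] := eq_up_to_phase e1 e2.
apply: (@monic_compr _ _ _ _ r); rewrite rm; apply: monic_comp.
  exact: in2_monic.
exact/is_iso_monic/phase_iso.
Qed.

(* [t : X +. Y -> T] merges the two copies of [I]; a section of [t] up to a
   phase is obtained from the presentation [X +. B] of [T]. *)
Lemma merged_jointly_epic (T : phased_sum X B) (kY : Hom Y T) (Z : C)
    (iZ : Hom I Z) (h h' : Hom T Z) :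
  kY ∘ in1 Y = in2 T -> kY ∘ in2 Y = in1 T ∘ in2 X -> monic iZ ->
  h ∘ (in1 T ∘ in2 X) = iZ ->
  h ∘ in1 T = h' ∘ in1 T -> h ∘ kY = h' ∘ kY -> h = h'.
Proof.
move=> kYB kYI iZm hI hX hY.
have [T' _] := phased_sum_exists Cfin X Y.
have [S _] := phased_sum_exists Cfin I I.
have [t [tX tY]] := cotuple T' (in1 T) kY.
have [s [sX sB]] := cotuple T (in1 T') (in2 T' ∘ in1 Y).
have ts_iso : is_iso (t ∘ s).
  apply: phase_iso; apply/phaseP.
  by rewrite -!compmA sX sB tX compmA tY kYB.
suff th : h ∘ t = h' ∘ t by apply: (is_iso_epic ts_iso); rewrite !compmA th.
have [m [m1 m2]] := cotuple S (in1 T' ∘ in2 X) (in2 T' ∘ in2 Y).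
have mm := generator_pair_monic m1 m2.
have m_diag : diagonal m by split; [exists (in2 X)|exists (in2 Y)].
have [d [d1 d2]] := cotuple S (idm I) (idm I).
have d_mon := proj1 Igen S d d1 d2.
pose iT := in1 T ∘ in2 X.
(* Up to a phase [V], [t ∘ m] is the codiagonal [d] followed by [iT]. *)
have tm1 : (iT ∘ d) ∘ in1 S = (t ∘ m) ∘ in1 S.
  by rewrite -!compmA m1 d1 compm1 (compmA t) tX.
have tm2 : (iT ∘ d) ∘ in2 S = (t ∘ m) ∘ in2 S.
  by rewrite -!compmA m2 d2 compm1 (compmA t) tY kYI.
have [V [phV tm]] := eq_up_to_phase tm1 tm2.
have h'I : h' ∘ iT = iZ by rewrite -hI /iT !compmA hX.
have t1 : (h ∘ t) ∘ in1 T' = (h' ∘ t) ∘ in1 T' by rewrite -!compmA tX.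
have t2 : (h ∘ t) ∘ in2 T' = (h' ∘ t) ∘ in2 T' by rewrite -!compmA tY.
have [U [phU htU]] := eq_up_to_phase t1 t2.
have [U1 U2] := proj1 (phaseP U) phU.
(* [U] fixes both copies of [I], hence restricts along [m] to a phase [W] of [I +. I]. *)
have Um1 : m ∘ in1 S = (U ∘ m) ∘ in1 S by rewrite -compmA m1 compmA U1.
have Um2 : m ∘ in2 S = (U ∘ m) ∘ in2 S by rewrite -compmA m2 compmA U2.
have [W [phW UmW]] := eq_up_to_phase Um1 Um2.
have iZE (u : Hom T Z) : u ∘ iT = iZ -> u ∘ t ∘ m = iZ ∘ (d ∘ V).
  by move=> <-; rewrite -compmA tm !compmA.
(* Both sides composed with [iZ] equal [h' ∘ t ∘ m], because [h' ∘ t = h ∘ t ∘ U]. *)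
have dVW : d ∘ (V ∘ W) = d ∘ V.
  apply: iZm; rewrite (compmA d) compmA -(iZE h hI) -compmA -UmW compmA -htU.
  by rewrite !iZE.
have V_mon : monic V by exact/is_iso_monic/phase_iso.
have W1 : W = idm S.
  apply: V_mon; rewrite compm1; apply: d_mon dVW => //.
  move/phaseP: phV => [V1 V2]; move/phaseP: phW => [W1 W2].
  by apply/phaseP; rewrite -!compmA W1 W2.
have U_id : U = idm T'.
  apply: (proj2 Igen S _ _ T' m m_diag mm) => //; first exact: phase1.
  by rewrite comp1m UmW W1 compm1.
by rewrite htU U_id compm1.
Qed.

End MergingGenerators.

Lemma gp_binary_coproduct (X Y : GP I) :
  exists (S : GP I) (k1 : Hom X S) (k2 : Hom Y S),
    monic k1 /\
    forall (Z : GP I) (f : Hom X Z) (g : Hom Y Z),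
      exists! h : Hom S Z, h ∘ k1 = f /\ h ∘ k2 = g.
Proof.
have [T _] := phased_sum_exists Cfin (gp_sum X) (gp_base Y).
have [P _] := phased_sum_exists Cfin (gp_base X) (gp_base Y).
have [k [kA kB]] := cotuple P (in1 T ∘ in1 X) (in2 T).
have [kY [kYB kYI]] := cotuple Y (in2 T) (in1 T ∘ in2 X).
(* The carrier is [T], reassociated as [P +. I]; its copy of [I] is the one in [X]. *)
pose S : GP I := GPOb (PhasedSum (reassociate Cfin kA kB)).
have k1P : @gp_hom_axiom C I X S (in1 T).
  by split=> //; split; [exists (in1 P)|exists (idm I); rewrite compm1].
have k2P : @gp_hom_axiom C I Y S kY.
  split=> //; split; last by exists (idm I); rewrite compm1.
  by exists (in2 P); rewrite kYB.
exists S, (exist _ (in1 T) k1P), (exist _ kY k2P); split.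
  move=> Z u v /(congr1 sval) /= uv; apply: gp_hom_eq.
  exact: (in1_monic Cmonic uv).
move=> Z f g.
have [f1 f1E] := proj1 (proj1 (proj2_sig f)).
have [g1 g1E] := proj1 (proj1 (proj2_sig g)).
have fI := proj2 (proj2_sig f); have gI := proj2 (proj2_sig g).
(* [h0] is correct on [X], but on [Y] only up to a phase [U]. *)
have [h0 [h0X h0B]] := cotuple T (sval f) (in1 Z ∘ g1).
have e1 : (h0 ∘ kY) ∘ in1 Y = sval g ∘ in1 Y by rewrite -compmA kYB h0B.
have e2 : (h0 ∘ kY) ∘ in2 Y = sval g ∘ in2 Y.
  by rewrite -compmA kYI compmA h0X fI gI.
have [U [/phaseP [U1 U2] gU]] := eq_up_to_phase e1 e2.
(* With its summands swapped, [Y] is [I +. B], for [B] the base of [Y], and [kY] is diagonal into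
   [X +. B]. *)
pose Ys := PhasedSum (phase_sum_swap Y).
have kY_diag : @diagonal C _ _ _ _ Ys T kY.
  by split; [exists (in2 X)|exists (idm _); rewrite compm1].
have [|W [/phaseP [WX WB] UW]] := Ctrans kY_diag (U := U).
  exact/phaseP.
have hX : (h0 ∘ W) ∘ in1 T = sval f by rewrite -compmA WX.
have hY : (h0 ∘ W) ∘ kY = sval g by rewrite -compmA -UW compmA.
have hP : @gp_hom_axiom C I S Z (h0 ∘ W).
  have hI : (h0 ∘ W) ∘ (in1 T ∘ in2 X) = in2 Z by rewrite compmA hX.
  split=> //; split; last by exists (idm I); rewrite compm1.
  (* The restriction to [P] factors through [in1 Z] as [p ∘ Q], with [Q] a phase of [P]. *)
  have [p [pA pB]] := cotuple P f1 g1.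
  have q1 : (in1 Z ∘ p) ∘ in1 P = (h0 ∘ W ∘ k) ∘ in1 P.
    by rewrite -!compmA pA kA (compmA W) WX compmA h0X f1E.
  have q2 : (in1 Z ∘ p) ∘ in2 P = (h0 ∘ W ∘ k) ∘ in2 P.
    by rewrite -!compmA pB kB WB h0B.
  have [Q [_ hQ]] := eq_up_to_phase q1 q2.
  by exists (p ∘ Q); rewrite /= hQ compmA.
exists (exist _ (h0 ∘ W) hP); split; first by split; exact: gp_hom_eq.
move=> h' [/(congr1 sval) /= h'X /(congr1 sval) /= h'Y]; apply: gp_hom_eq => /=.
apply: (merged_jointly_epic (iZ := in2 Z) kYB kYI).
- exact: in2_monic.
- by rewrite compmA hX.
- by rewrite hX h'X.
- by rewrite hY h'Y.
Qed.

End GPFacts.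

Theorem theorem4p3 (C : category) (I : C)
    (Hfin : has_finite_phased_coproducts C)
    (Hmonic : finite_phased_coproducts_monic C)
    (Htrans : transitive_phases C)
    (HI : phase_generator I) :
  has_finite_coproducts (GP I) /\
  finite_coproducts_monic (GP I) /\
  exists HT : trivial_isos (@gp_phase C I),
  exists Hresp : respects_triv (@gp_phase C I) (bracket I Hmonic),
    is_equivalence (induced HT Hresp).
Proof.
have bin := gp_binary_coproduct Hfin Hmonic Htrans HI.
split.
  apply: has_finite_coproducts_of_binary; first exact: gp_initial.
  by move=> X Y; have [S [k1 [k2 [_ kP]]]] := bin X Y; exists S, k1, k2.
split.
  apply: finite_coproducts_monic_of_binary => X Y.
  have [S [k1 [k2 [k1m kP]]]] := bin X Y; exists S, k1, k2; split=> // Z f g.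
  by have [h [hE _]] := kP Z f g; exists h.
exists (gp_trivial_isos I).
have Hresp : respects_triv (@gp_phase C I) (bracket I Hmonic).
  by move=> X Y f g fg; apply/bracket_eqP.
by exists Hresp; exact: bracket_equivalence.
Qed.
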